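(* Let $(X_1,|\cdot|_1)$ and $(X_2,|\cdot|_2)$ be Banach spaces, let $K_1\subset X_1$ be a non-degenerate cone, and let $D\subset X_2$ be a nonempty, bounded, closed, convex set. Let $T=(T_1,T_2)\colon K_1\times D\to K_1\times D$ be a completely continuous operator, and let $\mathcal{F}\colon K_1\times K_1\to\mathbb{R}$ be a continuous functional such that for any $u\in K_1\setminus\{0\}$ and $\lambda>0$ one has $\mathcal{F}(\lambda u,u)=0$ if and only if $\lambda=1$. Assume that: (h1) for every $(u,v)\in (K_1\setminus\{0\})\times D$ there exists a unique number $s(u,v)>0$ such that $\mathcal{F}\bigl(T_1(s(u,v)u,v),\,s(u,v)u\bigr)=0$; (h2) there exist $0<m<M<\infty$ such that $\inf_{S^1_{K_1}\times D}s(\cdot,\cdot)>m$ and $\sup_{S^1_{K_1}\times D}s(\cdot,\cdot)<M$, where $S^1_{K_1}:=\{u\in K_1: |u|_1=1\}$. Then the operator $(T_1,T_2)$ admits a fixed point $(u,v)\in K_1\times D$, i.e. $T_1(u,v)=u$ and $T_2(u,v)=v$. If in addition the operator $(T_1,T_2)$ has no fixed point of the form $(0,\bar v)$ with $\bar v\in D$, then $(u,v)\in U_b$, where $U_b=\{(u,v)\in (K_1\setminus\{0\})\times D : s(u,v)=1\}$.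
   Context: A non-degenerate cone in a Banach space is a closed, convex set $K_1$ with $\lambda K_1\subset K_1$ for all $\lambda\in\mathbb{R}_+=[0,\infty)$ and $K_1\setminus\{0\}\neq\emptyset$. An operator is completely continuous if it is continuous and maps bounded sets into relatively compact sets. Product spaces carry the product topology. *)

(* Defs.v *)
From HB Require Import structures.
From mathcomp Require Import all_boot all_order all_algebra.
From mathcomp Require Import all_classical all_reals all_analysis.

Set Implicit Arguments.
Unset Strict Implicit.
Unset Printing Implicit Defensive.

Import Order.TTheory GRing.Theory Num.Theory.
Import numFieldNormedType.Exports.

Local Open Scope classical_set_scope.
Local Open Scope ring_scope.

(* [K `&` (- K) = [set 0]] is not part of the definition: a linear subspace
   is allowed. *)
Definition nondegenerate_cone (R : realType) (X : normedModType R)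
    (K : set X) : Prop :=
  [/\ closed K, convex_set K,
      (forall (l : R) (x : X), 0 <= l -> K x -> K (l *: x))
    & K `\ 0 !=set0].

(* The operator has domain [A]; the values of [f] outside [A] play no role. *)
Definition completely_continuous (R : realType) (X Y : normedModType R)
    (A : set X) (f : X -> Y) : Prop :=
  {within A, continuous f} /\
  forall B : set X, B `<=` A -> bounded_set B -> precompact (f @` B).

Definition unit_sphere (R : realType) (X : normedModType R) (K : set X)
    : set X :=
  [set u | K u /\ `|u| = 1].

Definition Ub (R : realType) (X1 X2 : normedModType R) (K1 : set X1)
    (D : set X2) (s : X1 * X2 -> R) : set (X1 * X2) :=
  [set p | ((K1 `\ 0) `*` D) p /\ s p = 1].

(* Main.v *)
Require Import Defs.
From HB Require Import structures.
From mathcomp Require Import all_boot all_order all_algebra.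
From mathcomp Require Import zify lra.

(** By (h1), [s] is homogeneous of degree [-1] in [u]; with (h2) this bounds [s]
    locally, and since its graph is closed, [s] is continuous on [(K1 \ 0) x D].
    Hence [r (u, v) := (min 1 (s (u, v)) *: u, v)] is a continuous retraction of
    [K1 x D] onto the bounded star-shaped set where [u = 0] or [s >= 1], and
    Schauder's theorem gives a fixed point [(u, v)] of [T \o r]. If
    [s (u, v) < 1], then [w := s (u, v) *: u] satisfies [F (u, w) = 0] with
    [u = (s (u, v))^-1 *: w], contradicting the hypothesis on [F]; so
    [r (u, v) = (u, v)] is a fixed point of [T].

    Schauder's theorem is reduced to Brouwer's theorem on the simplex. The latter
    follows, with no triangulation, from a Sperner-type lemma of Scarf on a finite
    set carrying several total orders (see H. Petri and M. Voorneveld, "No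
    bullying! A playful proof of Brouwer's fixed-point theorem"). *)

Set Implicit Arguments.
Unset Strict Implicit.
Unset Printing Implicit Defensive.

(** * Rainbow dominant sets *)

Section Scarf.
Context {X I : finType} (rk : I -> X -> nat).
Context (rk_inj : forall i, injective (rk i)).

Definition lower_bound (Y : {set X}) (i : I) (x : X) : bool :=
  [forall y in Y, rk i x <= rk i y].

(** For nonempty [Y]: no point exceeds the minimum of [Y] in all the orders of [C] at once. For
    empty [Y], any index in [C] suffices. *)
Definition dominant (Y : {set X}) (C : {set I}) : bool :=
  [forall x, [exists i in C, lower_bound Y i x]].

Lemma dominantP (Y : {set X}) (C : {set I}) :
  reflect (forall x, exists2 i, i \in C & lower_bound Y i x) (dominant Y C).
Proof.
apply: (iffP forallP) => h x; first by have /exists_inP := h x.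
by apply/exists_inP; exact: h.
Qed.

Lemma dominantS (Y Y' : {set X}) (C C' : {set I}) :
  Y' \subset Y -> C \subset C' -> dominant Y C -> dominant Y' C'.
Proof.
move=> /subsetP YY /subsetP CC /dominantP h; apply/dominantP => x.
have [i iC /forall_inP lx] := h x; exists i; first exact: CC.
by apply/forall_inP => y /YY; exact: lx.
Qed.

(* Pairs [d] with one index more than points ("doors") are faces of the pairs
   [r] with as many points as indices ("rooms"), obtained by adding a point or
   dropping an index. *)
Definition incident (d r : {set X} * {set I}) : bool :=
  [exists x, (x \notin d.1) && (r == (x |: d.1, d.2))] ||
  [exists j, (j \notin r.2) && (d == (r.1, j |: r.2))].

Lemma incidentP (d r : {set X} * {set I}) :
  reflect ((exists2 x, x \notin d.1 & r = (x |: d.1, d.2)) \/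
           (exists2 j, j \notin r.2 & d = (r.1, j |: r.2))) (incident d r).
Proof.
apply: (iffP orP) => -[].
- by move=> /existsP[x /andP[xd /eqP rE]]; left; exists x.
- by move=> /existsP[j /andP[jr /eqP dE]]; right; exists j.
- by move=> [x xd rE]; left; apply/existsP; exists x; rewrite xd rE eqxx.
- by move=> [j jr dE]; right; apply/existsP; exists j; rewrite jr dE eqxx.
Qed.

Definition room (r : {set X} * {set I}) : bool :=
  dominant r.1 r.2 && (#|r.1| == #|r.2|).

(** For nonempty [Y], these points lie beyond the minimum of [Y] in every order of [C] except [i],
    so adding one of them leaves those minima in place. *)
Definition above (Y : {set X}) (C : {set I}) (i : I) : {set X} :=
  [set x | [forall j in C :\ i, ~~ lower_bound Y j x]].

Lemma aboveP (Y : {set X}) (C : {set I}) (i : I) (x : X) :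
  reflect (forall j, j \in C -> j != i -> ~~ lower_bound Y j x)
          (x \in above Y C i).
Proof.
rewrite inE; apply: (iffP forall_inP) => h j.
  by move=> jC ji; apply: h; rewrite !inE ji.
by rewrite !inE => /andP[ji jC]; exact: h.
Qed.

(* The room entered from the door [(Y, C)] when [i] gives up its present minimum:
   its new point is the [i]-highest one above the other minima, if any. *)
Definition pivot (Y : {set X}) (C : {set I}) (i : I) : {set X} * {set I} :=
  if [pick x in above Y C i | [forall z in above Y C i, rk i z <= rk i x]]
    is Some x then (x |: Y, C) else (Y, C :\ i).

Variant pivot_spec (Y : {set X}) (C : {set I}) (i : I) :
    {set X} * {set I} -> Type :=
| PivotAdd x of x \in above Y C i
    & (forall z, z \in above Y C i -> rk i z <= rk i x) :
    pivot_spec Y C i (x |: Y, C)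
| PivotRemove of (forall x, x \notin above Y C i) :
    pivot_spec Y C i (Y, C :\ i).

Lemma pivotP (Y : {set X}) (C : {set I}) (i : I) :
  pivot_spec Y C i (pivot Y C i).
Proof.
rewrite /pivot; case: pickP => [x /andP[xM /forall_inP xmax]|no].
  exact: PivotAdd.
apply: PivotRemove => x; apply/negP => xM.
have := no [arg max_(z > x in above Y C i) rk i z].
case: arg_maxnP => //= z zM zmax; rewrite zM /= => /negP; apply.
by apply/forall_inP => w; exact: zmax.
Qed.

(** Ranks are injective, so the maximiser is unique and the choice made by [pick] is immaterial. *)
Lemma pivot_add (Y : {set X}) (C : {set I}) (i : I) (x : X) :
  x \in above Y C i -> (forall z, z \in above Y C i -> rk i z <= rk i x) ->
  pivot Y C i = (x |: Y, C).
Proof.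
move=> xM xmax; case: pivotP => [y yM ymax|/(_ x)]; last by rewrite xM.
suff -> : y = x by [].
by apply: (@rk_inj i); apply/eqP; rewrite eqn_leq xmax// ymax.
Qed.

Lemma pivot_remove (Y : {set X}) (C : {set I}) (i : I) :
  (forall x, x \notin above Y C i) -> pivot Y C i = (Y, C :\ i).
Proof. by move=> no; case: pivotP => // x xM; have := no x; rewrite xM. Qed.

Lemma lower_bound_above (Y : {set X}) (C : {set I}) (i : I) (x : X) :
  dominant Y C -> x \in above Y C i -> lower_bound Y i x.
Proof.
move=> /dominantP/(_ x)[j jC lj] /aboveP xM.
by have [<-//|ji] := eqVneq j i; have := xM j jC ji; rewrite lj.
Qed.

(** A point of [above Y C i] is ranked at most [x] by [i], and [x] is below [Y] there. Any other
    point has a witness [j != i], in whose order [x] exceeds some point of [Y], so [j] remains a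
    witness once [x] is added. *)
Lemma dominant_pivot_add (Y : {set X}) (C : {set I}) (i : I) (x : X) :
  i \in C -> dominant Y C ->
  x \in above Y C i -> (forall z, z \in above Y C i -> rk i z <= rk i x) ->
  dominant (x |: Y) C.
Proof.
move=> iC dom xM xmax; apply/dominantP => z.
have lx := lower_bound_above dom xM.
have [zM|] := boolP (z \in above Y C i).
  exists i => //; apply/forall_inP => y /setU1P[->|yY]; first exact: xmax.
  by move/forall_inP: lx => lx; rewrite (leq_trans (xmax z zM))// lx.
rewrite inE negb_forall => /existsP[j]; rewrite negb_imply negbK !inE.
move=> /andP[/andP[ji jC] lz]; exists j => //.
move/aboveP: xM => /(_ j jC ji); rewrite negb_forall => /existsP[w].
rewrite negb_imply -ltnNge => /andP[wY wx].
move/forall_inP: lz => lz.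
apply/forall_inP => y /setU1P[->|]; last exact: lz.
by rewrite (leq_trans (lz w wY))// ltnW.
Qed.

Lemma dominant_pivot_remove (Y : {set X}) (C : {set I}) (i : I) :
  (forall x, x \notin above Y C i) -> dominant Y (C :\ i).
Proof.
move=> no; apply/dominantP => x; have := no x.
rewrite inE negb_forall => /existsP[j]; rewrite negb_imply negbK => /andP[jC lx].
by exists j.
Qed.

(** Converse of [dominant_pivot_remove]; it identifies a room reached by dropping an index as a
    pivot. *)
Lemma dominant_remove_above (Y : {set X}) (C : {set I}) (i : I) (x : X) :
  dominant Y (C :\ i) -> x \notin above Y C i.
Proof.
move=> /dominantP/(_ x)[j /setD1P[ji jC] lj]; apply/negP => /aboveP/(_ j jC ji).
by rewrite lj.
Qed.

(** With no minimum to exceed, every point is a candidate, so the room adds the [i]-highest one;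
    dropping [i] instead would leave no index to witness [x0]. *)
Lemma card_rooms_empty (x0 : X) (i : I) :
  #|[set r | room r & incident (set0, [set i]) r]| = 1.
Proof.
have dom : dominant set0 [set i].
  apply/dominantP => x; exists i; first exact: set11.
  by apply/forall_inP => y; rewrite inE.
have M x : x \in above set0 [set i] i.
  by apply/aboveP => j /set1P ->; rewrite eqxx.
suff -> : [set r | room r & incident (set0, [set i]) r] =
    [set pivot set0 [set i] i] by rewrite cards1.
apply/setP => r; rewrite !inE; apply/andP/eqP => [[/andP[rd rc] /incidentP[]]|->].
- move=> [x _ rE]; rewrite rE in rd *; apply/esym/pivot_add => // z _.
  move/dominantP: rd => /(_ z) /= [j /set1P -> /forall_inP]; apply.
  by rewrite setU11.
- case=> j jr /= [r0 /esym/setP rE]; exfalso.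
  have r20 : r.2 = set0.
    by apply/eqP; rewrite -cards_eq0 -(eqP rc) -r0 cards0.
  move/dominantP: rd => /(_ x0) [k]; by rewrite r20 inE.
- case: pivotP => [x xM xmax|/(_ x0)]; last by rewrite M.
  split; last first.
    by apply/incidentP; left; exists x; rewrite ?inE.
  rewrite /room /= setU0 !cards1 eqxx andbT -[[set x]]setU0.
  exact: dominant_pivot_add (set11 i) dom xM xmax.
Qed.

(* Every point of [Y] is the minimum of [Y] for some index of [C], so exactly one
   of them is so for two indices [a] and [b]; the two rooms are the pivots at
   [a] and [b]. *)
Lemma card_rooms (Y : {set X}) (C : {set I}) :
  Y != set0 -> dominant Y C -> #|Y|.+1 = #|C| ->
  #|[set r | room r & incident (Y, C) r]| = 2.
Proof.
move=> /set0Pn[y0 y0Y] dom cYC.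
pose mn (Z : {set X}) i := [arg min_(y < y0 in Z) rk i y].
have mnP (Z : {set X}) i : y0 \in Z -> mn Z i \in Z /\ lower_bound Z i (mn Z i).
  move=> y0Z; rewrite /mn; case: arg_minnP => //= y yZ ymin; split => //.
  exact/forall_inP.
have mn_eq (Z : {set X}) i y :
    y0 \in Z -> y \in Z -> lower_bound Z i y -> y = mn Z i.
  move=> y0Z yZ /forall_inP ly; have [mZ /forall_inP lm] := mnP Z i y0Z.
  by apply: (@rk_inj i); apply/eqP; rewrite eqn_leq ly// lm.
have mn_onto (Z : {set X}) B : y0 \in Z -> dominant Z B -> mn Z @: B = Z.
  move=> y0Z /dominantP dZ; apply/setP => y; apply/imsetP/idP => [[i _ ->]|yZ].
    by have [] := mnP Z i y0Z.
  by have [i iB ly] := dZ y; exists i => //; exact: mn_eq.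
have mY := mn_onto Y C y0Y dom.
have : ~~ [forall a in C, forall b in C, (mn Y a == mn Y b) ==> (a == b)].
  apply/negP => /forall_inP h.
  have /card_in_imset : {in C &, injective (mn Y)}.
    move=> a b aC bC /eqP ab; apply/eqP.
    by have /forall_inP/(_ b bC)/implyP := h a aC; exact.
  by rewrite mY -cYC => /eqP; rewrite ltn_eqF.
rewrite negb_forall => /existsP[a]; rewrite negb_imply => /andP[aC].
rewrite negb_forall => /existsP[b]; rewrite negb_imply => /andP[bC].
rewrite negb_imply => /andP[/eqP mab neab].
have cD i : i \in C -> #|C :\ i| = #|Y|.
  by move=> iC; have := cardsD1 i C; rewrite iC -cYC => -[].
(* Otherwise [a] and [b] both remain in [C :\ i] and share their minimum. *)
have inj_ab i : i \in C -> {in C :\ i &, injective (mn Y)} -> i = a \/ i = b.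
  move=> iC inj; have [->|ia] := eqVneq i a; first by left.
  have [->|ib] := eqVneq i b; first by right.
  have : a = b by apply: inj => //; rewrite !inE eq_sym ?ia ?ib.
  by move/eqP; rewrite (negbTE neab).
have onto_ab i : i \in C -> mn Y @: (C :\ i) = Y -> i = a \/ i = b.
  move=> iC mi; apply: inj_ab => //; apply/imset_injP.
  by rewrite mi cD.
have onto i : i = a \/ i = b -> i \in C /\ mn Y @: (C :\ i) = Y.
  move=> iab; have iC : i \in C by case: iab => ->.
  split=> //; apply/eqP; rewrite eqEsubset; apply/andP; split.
    by have := imsetS (mn Y) (subD1set C i); rewrite mY.
  apply/subsetP => y; rewrite -{1}mY => /imsetP[j jC ->].
  have [->|ji] := eqVneq j i; last by apply: imset_f; rewrite !inE ji.
  case: iab => ->; [rewrite mab|rewrite -mab]; apply: imset_f; rewrite !inE.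
    by rewrite eq_sym neab.
  by rewrite neab.
have aboveNY i x : i = a \/ i = b -> x \in above Y C i -> x \notin Y.
  move=> /onto[iC mi] /aboveP xM; apply/negP; rewrite -mi => /imsetP[j].
  rewrite !inE => /andP[ji jC] xE; have := xM j jC ji.
  by rewrite xE; have [_ ->] := mnP Y j y0Y.
have pivot_room i : i = a \/ i = b ->
    pivot Y C i \in [set r | room r & incident (Y, C) r].
  move=> iab; have [iC _] := onto i iab; rewrite inE /room.
  case: pivotP => [x xM xmax|no] /=.
    have xY := aboveNY i x iab xM.
    rewrite (dominant_pivot_add iC dom xM xmax) cardsU1 xY add1n cYC eqxx /=.
    by apply/incidentP; left; exists x.
  rewrite dominant_pivot_remove// cD// eqxx /=.
  by apply/incidentP; right; exists i; rewrite /= ?setD11 ?setD1K.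
(* If both pivots added the same point, it would exceed the minima in all orders of [C], against
   dominance. If at least one drops an index, the index sets differ. *)
have pivot_neq : pivot Y C a != pivot Y C b.
  have CD i B : i \in C -> C = B :\ i -> False.
    by move=> iC /setP/(_ i); rewrite iC setD11.
  apply/eqP; case: (pivotP Y C a) => [x xM xmax|no];
    case: pivotP => [x' x'M x'max|no'].
  - move=> [/setP/(_ x)]; rewrite setU11 => /esym/setU1P[xx|xY].
      rewrite -xx in x'M; have /dominantP/(_ x)[j jC lj] := dom.
      have [ja|ja] := eqVneq j a.
        by move/aboveP: x'M => /(_ j jC); rewrite ja neab -ja lj => /(_ isT).
      by move/aboveP: xM => /(_ j jC ja); rewrite lj.
    by have := aboveNY a x (or_introl erefl) xM; rewrite xY.
  - by move=> [_]; exact: CD.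
  - by move=> [_ /esym]; exact: CD.
  - move=> [/setP/(_ a)]; rewrite !inE eqxx aC/= => /esym/negbT.
    by rewrite neab.
suff -> : [set r | room r & incident (Y, C) r] =
    [set pivot Y C a; pivot Y C b] by rewrite cards2 pivot_neq.
apply/eqP; rewrite eqEsubset; apply/andP; split; last first.
  by apply/subsetP => r /set2P[] ->; apply: pivot_room; [left|right].
suff sub r : room r -> incident (Y, C) r ->
    exists2 i, i = a \/ i = b & r = pivot Y C i.
  apply/subsetP => r; rewrite inE => /andP[rr ir].
  by have [i [] -> ->] := sub r rr ir; rewrite !inE eqxx ?orbT.
move=> /andP[rd /eqP rc] /incidentP[[x xY /= rE]|[j jr /= [YE CE]]]; last first.
  have rE : r.2 = C :\ j by rewrite CE setU1K.
  rewrite -YE rE in rd.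
  exists j; first by apply: onto_ab; [rewrite CE setU11|exact: mn_onto].
  rewrite pivot_remove; first by case: r rE YE {rd rc jr CE} => ? ? /= -> ->.
  by move=> x; exact: dominant_remove_above.
rewrite rE /= in rd rc.
(* The room adds [x]. It has as many points as indices, so its minima form a bijection and [x] is
   the minimum for a single [j]. The other indices keep their minima in [Y], which makes [mn Y]
   injective off [j] and forces [j] to be [a] or [b]. *)
have y0Z : y0 \in x |: Y by rewrite !inE y0Y orbT.
have mZ := mn_onto _ _ y0Z rd.
have injZ : {in C &, injective (mn (x |: Y))}.
  by apply/imset_injP; rewrite mZ rc.
have : x \in mn (x |: Y) @: C by rewrite mZ setU11.
move=> /imsetP[j jC xE].
have mn_same i : i \in C -> i != j -> mn (x |: Y) i = mn Y i.
  move=> iC ij; have [] := mnP (x |: Y) i y0Z => /setU1P[mx|mY' lm].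
    by move: ij; rewrite (injZ i j iC jC) ?eqxx// mx.
  apply: mn_eq => //; apply/forall_inP => y yY; move/forall_inP: lm; apply.
  by rewrite !inE yY orbT.
exists j.
  apply: inj_ab => // i k /setD1P[ij iC] /setD1P[kj kC].
  by rewrite -!mn_same//; exact: injZ.
rewrite rE (pivot_add (x:=x))//.
  apply/aboveP => i iC ij; apply/negP => /forall_inP lx.
  have [mY' _] := mnP Y i y0Y.
  have [mZ' /forall_inP lm] := mnP (x |: Y) i y0Z.
  have : x = mn (x |: Y) i.
    apply: mn_eq => //; first exact: setU11.
    by apply/forall_inP => y /setU1P[->//|]; exact: lx.
  by rewrite mn_same// => xE'; move: xY; rewrite xE' mY'.
move=> z zM; move/dominantP: rd => /(_ z)[i iC lz].
have [ij|ij] := eqVneq i j.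
  by rewrite ij in lz; move/forall_inP: lz; apply; exact: setU11.
move/aboveP: zM => /(_ i iC ij) /negP; case; apply/forall_inP => y yY.
by move/forall_inP: lz; apply; rewrite !inE yY orbT.
Qed.

(** * Parity of the number of doors of a room *)

Definition door (c : X -> I) (i0 : I) (d : {set X} * {set I}) : bool :=
  [&& dominant d.1 d.2, #|d.1|.+1 == #|d.2|, i0 \in d.2
    & c @: d.1 == d.2 :\ i0].

(** There are no doors or exactly two. Given one, some [x] has [c @: (Y :\ x) = C :\ i0], and
    [c x != i0] as the room is not rainbow. If [c x] is in [C], it is shared with one other point
    [x'], and the doors drop [x] or [x']; if not, they drop [x] or add the index [c x]. *)
Lemma even_doors (c : X -> I) (i0 : I) (r : {set X} * {set I}) :
  room r -> c @: r.1 != r.2 -> ~~ odd #|[set d | door c i0 d & incident d r]|.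
Proof.
case: r => Y C /andP[/= dom /eqP cYC] /eqP nrb.
set S := [set _ | _].
have [->|/set0Pn[d0 d0S]] := eqVneq S set0; first by rewrite cards0.
(* [x] is the point missing from the door or, if the door has an extra index [j], the point of
   colour [j]. *)
have [x [xY i0C cx]] : exists x, [/\ x \in Y, i0 \in C & c @: (Y :\ x) = C :\ i0].
  move: d0S; rewrite inE => /andP[/and4P[_ _ i0d /eqP cd]].
  move=> /incidentP[[x xd [YE CE]]|[j /= jC dE]].
    by exists x; rewrite YE CE setU11 setU1K.
  rewrite dE /= in i0d cd.
  have i0j : i0 != j.
    apply/eqP => ij; apply: nrb; rewrite cd; rewrite ij setU1K //.
  have i0C : i0 \in C by move: i0d; rewrite !inE (negbTE i0j).
  have cjD : #|(j |: C) :\ i0| = #|C|.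
    have := cardsD1 i0 (j |: C); rewrite i0d cardsU1 jC => /eqP.
    by rewrite eqSS => /eqP.
  have cinj : {in Y &, injective c} by apply/imset_injP; rewrite cd cjD cYC.
  have : j \in c @: Y by rewrite cd !inE eq_sym i0j eqxx.
  move=> /imsetP[x xY jE]; exists x; split=> //.
  apply/setP => k; rewrite !inE; apply/imsetP/andP => [[y]|[ki kC]].
    rewrite !inE => /andP[yx yY] ->.
    have : c y \in c @: Y by apply: imset_f.
    rewrite cd !inE => /andP[-> /orP[/eqP cyj|->//]].
    by move: yx; rewrite (cinj y x) ?eqxx// cyj.
  have : k \in c @: Y by rewrite cd !inE ki kC orbT.
  move=> /imsetP[y yY kE]; exists y => //; rewrite !inE yY andbT.
  by apply/eqP => yx; move: jC; rewrite jE -yx -kE kC.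
have cC : #|C :\ i0| = #|Y :\ x|.
  by have := cardsD1 x Y; have := cardsD1 i0 C; rewrite xY i0C; lia.
have cinj : {in Y :\ x &, injective c} by apply/imset_injP; rewrite cx cC.
have cYE : c @: Y = c x |: (C :\ i0).
  by rewrite -{1}(setD1K xY) imsetU1 cx.
have cxi0 : c x != i0.
  by apply/eqP => cxE; apply: nrb; rewrite cYE cxE setD1K.
have type1 z : z \in Y -> (Y :\ z, C) \in S = (c @: (Y :\ z) == C :\ i0).
  move=> zY; rewrite inE /door /= i0C.
  have -> : dominant (Y :\ z) C by apply: dominantS dom => //; exact: subD1set.
  have -> : #|Y :\ z|.+1 == #|C| by rewrite -cYC (cardsD1 z Y) zY.
  rewrite /=; case: eqP => //= _; apply/incidentP; left; exists z => /=.
    by rewrite setD11.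
  by rewrite setD1K.
have Scase d : d \in S ->
    (exists z, [/\ z \in Y, d = (Y :\ z, C) & c @: (Y :\ z) = C :\ i0]) \/
    (exists j, [/\ j \notin C, d = (Y, j |: C) & c @: Y = (j |: C) :\ i0]).
  rewrite inE => /andP[/and4P[_ _ _ /eqP cd]].
  move=> /incidentP[[z zd [YE CE]]|[j /= jC dE]].
    left; exists z; rewrite YE CE setU11 setU1K//; split=> //.
    by case: d {cd zd YE CE}.
  by right; exists j; rewrite dE in cd *.
suff [d2 neq SE] : exists2 d2, (Y :\ x, C) != d2 & S = [set (Y :\ x, C); d2].
  by rewrite SE cards2 neq.
have [cxC|cxC] := boolP (c x \in C).
  have : c x \in c @: (Y :\ x) by rewrite cx !inE cxi0.
  move=> /imsetP[x' x'Y cxE].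
  have /setD1P[x'x x'Y'] := x'Y.
  exists (Y :\ x', C).
    apply/eqP => -[/setP/(_ x)]; rewrite !inE eqxx xY andbT/= => /esym/negbT.
    by rewrite eq_sym x'x.
  apply/setP => d; rewrite in_set2; apply/idP/orP => [|[]/eqP->].
  - case/Scase=> [[z [zY -> cz]]|[j [jC _ cY]]]; last first.
      exfalso; have : j \in c @: Y.
        rewrite cY !inE eqxx andbT/=.
        by apply: contraNN jC => /eqP ->.
      rewrite cYE => /setU1P[jE|/setD1P[_ jC']]; last by rewrite jC' in jC.
      by rewrite jE cxC in jC.
    have [->|zx] := eqVneq z x; first by left.
    right; suff -> : z = x' by [].
    have : c z \in c @: (Y :\ z).
      have : c z \in c @: (Y :\ x) by apply: imset_f; rewrite !inE zx.
      by rewrite cx cz.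
    move=> /imsetP[w /setD1P[wz wY] czE].
    have [wx|wx] := eqVneq w x.
      by apply: cinj => //; rewrite ?inE ?zx//= czE wx.
    by move: wz; rewrite (cinj w z) ?eqxx// !inE ?wx ?zx.
  - by rewrite type1// cx.
  - rewrite type1//; apply/eqP/setP => k; rewrite -cx.
    apply/imsetP/imsetP => -[w /setD1P[ne wY] kE].
      have [wx|wx] := eqVneq w x; last by exists w; rewrite // !inE wx.
      by exists x' => //; rewrite kE wx.
    have [wx|wx] := eqVneq w x'; last by exists w; rewrite // !inE wx.
    exists x; last by rewrite kE wx.
    by rewrite !inE eq_sym x'x.
exists (Y, c x |: C).
  by apply/eqP => -[/setP/(_ x)]; rewrite setD11 xY.
apply/setP => d; rewrite in_set2; apply/idP/orP => [|[]/eqP->].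
- case/Scase=> [[z [zY -> cz]]|[j [jC -> cY]]].
    have [->|zx] := eqVneq z x; first by left.
    exfalso; have : c x \in c @: (Y :\ z).
      by apply: imset_f; rewrite !inE eq_sym zx.
    by rewrite cz !inE (negbTE cxC) andbF.
  right; suff -> : j = c x by [].
  have : c x \in c @: Y by exact: imset_f.
  by rewrite cY !inE (negbTE cxC) orbF => /andP[_ /eqP].
- by rewrite type1// cx.
rewrite inE; apply/andP; split.
  rewrite /door /= !inE i0C orbT cardsU1 cxC -cYC add1n eqxx /=.
  rewrite (dominantS _ _ dom)//=; last exact: subsetU1.
  apply/eqP; rewrite cYE; apply/setP => k; rewrite !inE.
  by have [->|] := eqVneq k (c x); rewrite ?cxi0.
by apply/incidentP; right; exists (c x).
Qed.

(* Double counting of incidences modulo 2: without a rainbow room every room has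
   evenly many doors, but the door [(set0, [set i0])] has a single room while all
   the others have two. *)
Theorem rainbow_dominant (c : X -> I) (x0 : X) :
  exists (Y : {set X}) (C : {set I}), dominant Y C /\ c @: Y = C.
Proof.
pose i0 := c x0.
case: (pickP (fun r => room r && (c @: r.1 == r.2))) => [[Y C]|none].
  by move=> /andP[/andP[/= dom _] /eqP cY]; exists Y, C.
exfalso.
pose N := \sum_(d | door c i0 d) \sum_(r | room r && incident d r) 1.
have evenN : ~~ odd N.
  rewrite /N (exchange_big_dep room) /=; last by move=> d r _ /andP[].
  elim/big_ind: _ => //= [m n|r rr].
    by rewrite oddD => /negbTE -> /negbTE ->.
  have := @even_doors c i0 r rr; have := none r; rewrite rr /= => /negbT ->.
  by move=> /(_ isT); rewrite -sum1dep_card.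
have : odd N.
  have d0 : door c i0 (set0, [set i0]).
    rewrite /door /= cards0 cards1 set11 imset0 setDv !eqxx !andbT.
    apply/dominantP => x; exists i0; first exact: set11.
    by apply/forall_inP => y; rewrite inE.
  rewrite /N (bigD1 (set0, [set i0]))//= sum1dep_card (card_rooms_empty x0 i0).
  rewrite oddD /= -[X in ~~ X]/(odd _).
  elim/big_ind: _ => //= [m n|[Y C] /andP[/and4P[/= dom /eqP cYC i0C cY] ne]].
    by rewrite oddD => /negbTE -> /negbTE ->.
  rewrite sum1dep_card card_rooms//.
  (* A door without points has a single index, which must be [i0]. *)
  apply/eqP => Y0; move: ne; rewrite Y0 xpair_eqE eqxx /=.
  rewrite Y0 cards0 in cYC.
  move/eqP: cYC; rewrite eq_sym => /cards1P[k CE].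
  by move: i0C; rewrite CE => /set1P ->; rewrite eqxx.
by rewrite (negbTE evenN).
Qed.

End Scarf.

From mathcomp Require Import all_classical all_reals all_analysis finmap.

Import Order.TTheory GRing.Theory Num.Theory.
Import numFieldNormedType.Exports.

(** * Brouwer's theorem on the simplex *)

(** Integer points of the simplex dilated by [N]. The bound on the coordinates follows from their
    sum and is built in to obtain a finite type. *)
Definition grid (n N : nat) : finType :=
  {k : {ffun 'I_n -> 'I_N.+1} | \sum_i (k i : nat) == N}.

Definition gridc (n N : nat) (z : grid n N) (i : 'I_n) : nat := val z i.

Lemma sum_gridc (n N : nat) (z : grid n N) : \sum_i gridc z i = N.
Proof. exact/eqP/(valP z). Qed.

Lemma grid_exists (n N : nat) (k : 'I_n -> nat) :
  \sum_i k i = N -> exists z : grid n N, gridc z =1 k.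
Proof.
move=> sk; have kN i : k i < N.+1 by rewrite ltnS -sk (bigD1 i)//= leq_addr.
have P : \sum_i ([ffun i => Ordinal (kN i)] i : nat) == N.
  by rewrite -[X in _ == X]sk; apply/eqP/eq_bigr => i _; rewrite ffunE.
pose Q (k : {ffun 'I_n -> 'I_N.+1}) := \sum_i (k i : nat) == N.
by exists (exist Q _ P) => i; rewrite /gridc /= ffunE.
Qed.

Lemma sum_delta (n : nat) (i : 'I_n) (a : nat) :
  \sum_j (if j == i then a else 0) = a.
Proof. by rewrite -big_mkcond big_pred1_eq. Qed.

(* Dominance forces [\sum_(j in C) min_Y y_j > N - #|C|]: otherwise a grid point
   would exceed all the minima. Hence [Y] has diameter at most [n] and its
   coordinates outside [C] are at most [n]. *)
Lemma grid_rainbow (n N : nat) (c : grid n.+1 N -> 'I_n.+1) :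
  exists z : grid n.+1 N, forall i, exists y : grid n.+1 N,
    (forall j, gridc y j <= gridc z j + n.+1 /\ gridc z j <= gridc y j + n.+1)
    /\ (c y = i \/ gridc y i <= n.+1).
Proof.
have [x0 _] := grid_exists (sum_delta (ord0 : 'I_n.+1) N).
(* The [i]-th coordinate, with ties broken by [enum_rank]. *)
pose rk (i : 'I_n.+1) (x : grid n.+1 N) :=
  gridc x i * #|grid n.+1 N| + enum_rank x.
have rk_lt i x y : gridc x i < gridc y i -> rk i x < rk i y.
  move=> xy; apply: leq_trans (leq_addr _ _).
  apply: leq_trans (leq_mul xy (leqnn _)); rewrite /rk mulSn.
  by rewrite [leqRHS]addnC -addnS leq_add2l ltn_ord.
have rk_inj i : injective (rk i).
  move=> x y rxy; have [] := ltngtP (gridc x i) (gridc y i).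
  - by move/rk_lt; rewrite rxy ltnn.
  - by move/rk_lt; rewrite rxy ltnn.
  - by move=> xyi; move: rxy; rewrite /rk xyi => /addnI/ord_inj/enum_rank_inj.
have [Y [C [/dominantP dom cY]]] := rainbow_dominant rk_inj c x0.
have [i0 i0C _] := dom x0.
have [z zY _] : exists2 z, z \in Y & i0 = c z by apply/imsetP; rewrite cY.
pose w j := [arg min_(y < z in Y) gridc y j].
have wP j : w j \in Y /\ forall y, y \in Y -> gridc (w j) j <= gridc y j.
  by rewrite /w; case: arg_minnP => //= y yY ymin.
pose m j := gridc (w j) j.
have big : N < \sum_(j in C) (m j).+1.
  rewrite ltnNge; apply/negP => le.
  (* One more than the minimum on [C], with the surplus placed at [i0] to reach the sum [N]. *)
  pose k j := (if j \in C then (m j).+1 else 0) +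
    (if j == i0 then N - \sum_(j in C) (m j).+1 else 0).
  have sk : \sum_j k j = N.
    by rewrite big_split /= sum_delta -big_mkcond /= subnKC.
  have [x xk] := grid_exists sk.
  have [j jC /forall_inP lj] := dom x.
  have [wY _] := wP j; have := lj _ wY; rewrite leqNgt rk_lt// xk /k jC.
  by rewrite /m; lia.
have cC : #|C| <= n.+1 by rewrite -[X in _ <= X]card_ord max_card.
rewrite (eq_bigr (fun j => m j + 1)) in big; last by move=> j _; rewrite addn1.
rewrite big_split /= sum1_card in big.
have mle y j : y \in Y -> m j <= gridc y j by move=> yY; have [_] := wP j; exact.
(* Used with [a], [b] the minimum and the coordinate of [y] at [j], [A], [B] their sums over the
   rest of [C], [r] the remaining coordinates of [y] and [e = #|C|]; for [j] outside [C],
   [a = 0]. *)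
have arith a A b B r e : N < a + A + e -> b + B + r = N -> A <= B ->
  e <= n.+1 -> b <= a + n by lia.
have near y j : y \in Y ->
    (if j \in C then m j else 0) <= gridc y j <= (if j \in C then m j else 0) + n.
  move=> yY; have := sum_gridc y; rewrite (bigID (mem C)) /= => sy.
  have le : \sum_(i in C) m i <= \sum_(i in C) gridc y i.
    by apply: leq_sum => i _; exact: mle.
  case: ifPn => [jC|jC].
    rewrite mle//=; rewrite (bigD1 j)//= in sy; rewrite (bigD1 j)//= in big.
    have le' : \sum_(i in C | i != j) m i <= \sum_(i in C | i != j) gridc y i.
      by apply: leq_sum => i _; exact: mle.
    exact: arith big sy le' cC.
  rewrite [X in (_ + X)%N](bigD1 j)//= addnCA addnA in sy.
  by apply: arith sy le cC; rewrite add0n; exact: big.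
(* For [i] in [C] some [y] in [Y] has colour [i]; for [i] outside [C], [near] bounds coordinate [i]
   of [z], and [y := z] will do. *)
exists z => i; have [iC|iC] := boolP (i \in C).
  move: (iC); rewrite -cY => /imsetP[y yY ->]; exists y; split; last by left.
  by move=> j; have := near y j yY; have := near z j zY; lia.
exists z; split; first by move=> j; lia.
by right; have := near z i zY; rewrite (negbTE iC); lia.
Qed.

Local Open Scope classical_set_scope.
Local Open Scope ring_scope.

(** * From the grid to the real simplex *)

Definition simplex (R : realType) (n : nat) : set 'rV[R]_n :=
  [set x | (forall i, 0 <= x ord0 i) /\ \sum_i x ord0 i = 1].
Arguments simplex : clear implicits.

Lemma simplex_le1 (R : realType) (n : nat) (x : 'rV[R]_n) i :
  simplex R n x -> 0 <= x ord0 i <= 1.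
Proof.
move=> [x0 <-]; rewrite x0 (bigD1 i)//= lerDl.
by apply: sumr_ge0.
Qed.

Lemma continuous_sum_coord (R : realType) (n : nat) :
  continuous (fun x : 'rV[R]_n => \sum_i x ord0 i).
Proof.
move=> x; apply: cvg_big => [||i _]; last exact: coord_continuous.
  exact: add_continuous.
exact: nbhs_filter.
Qed.

Lemma compact_simplex (R : realType) (n : nat) : compact (simplex R n).
Proof.
apply: (@subclosed_compact _ _
  [set x : 'rV[R]_n | forall i, `[0, 1]%classic (x ord0 i)]).
- rewrite (_ : simplex R n = \bigcap_(i : 'I_n) [set x | 0 <= x ord0 i] `&`
      [set x | \sum_i x ord0 i = 1]); last first.
    apply/seteqP; split=> [x [x0 x1]|x [x0 x1]]; split=> // i; last exact: x0.
    by move=> _; exact: x0.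
  apply: closedI.
    apply: closed_bigI => i _.
    have /continuous_closedP := @coord_continuous R 1 n ord0 i.
    by move/(_ _ (@closed_ge _ (0 : R))).
  have /continuous_closedP := @continuous_sum_coord R n.
  by move/(_ _ (@closed_eq _ (1 : R))).
- apply: (@rV_compact R n (fun=> `[0, 1]%classic)) => i.
  exact: segment_compact.
- by move=> x sx i /=; rewrite in_itv/=; exact: simplex_le1.
Qed.


(** Equal sums prevent [x] from exceeding [y] in every coordinate. With [y := g x], this provides
    the colour of a grid point. *)
Lemma simplex_label (R : realType) (n : nat) (x y : 'rV[R]_n.+1) :
  simplex R n.+1 x -> simplex R n.+1 y -> exists i, x ord0 i <= y ord0 i.
Proof.
move=> [_ sx] [_ sy]; apply: contrapT => /forallNP no.
have : \sum_i y ord0 i < \sum_i x ord0 i.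
  apply: ltr_sum => [|i _]; last by rewrite ltNge; apply/negP; exact: no.
  by apply/hasP; exists ord0; rewrite ?mem_index_enum.
by rewrite sx sy ltxx.
Qed.

Definition gridpt (R : realType) (n N : nat) (z : grid n N.+1) : 'rV[R]_n :=
  \row_i ((gridc z i)%:R / N.+1%:R).

Lemma simplex_gridpt (R : realType) (n N : nat) (z : grid n N.+1) :
  simplex R n (gridpt R z).
Proof.
split=> [i|]; first by rewrite mxE divr_ge0.
under eq_bigr do rewrite mxE.
by rewrite -mulr_suml -natr_sum sum_gridc divff.
Qed.

(** Colour each grid point by a coordinate that [g] does not decrease and apply [grid_rainbow].
    Where coordinate [i] of [y] is merely small, the last bound holds because [g y] has nonnegative
    coordinates. *)
Lemma simplex_approx_fixed (R : realType) (n N : nat)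
    (g : 'rV[R]_n.+1 -> 'rV[R]_n.+1) :
  set_fun (simplex R n.+1) (simplex R n.+1) g ->
  exists2 z : 'rV[R]_n.+1, simplex R n.+1 z & forall i, exists y,
    [/\ simplex R n.+1 y,
        forall j, `|z ord0 j - y ord0 j| <= n.+1%:R / N.+1%:R
      & y ord0 i <= g y ord0 i + n.+1%:R / N.+1%:R].
Proof.
move=> gS.
have lab (z : grid n.+1 N.+1) : exists i, gridpt R z ord0 i <= g (gridpt R z) ord0 i.
  by apply: simplex_label; [|apply: gS]; exact: simplex_gridpt.
have [c cP] := choice lab.
have [z zP] := grid_rainbow c; exists (gridpt R z); first exact: simplex_gridpt.
move=> i; have [y [yz ci]] := zP i; exists (gridpt R y).
split; first exact: simplex_gridpt.
  move=> j; rewrite !mxE -mulrBl normrM [X in _ * X]ger0_norm ?invr_ge0//.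
  rewrite ler_pM2r ?invr_gt0// ler_norml.
  have [] := yz j; rewrite -!(ler_nat R) !natrD => yz1 yz2.
  by apply/andP; split; lra.
have e0 : 0 <= n.+1%:R / N.+1%:R :> R by rewrite divr_ge0.
case: ci => [<-|yi]; first by rewrite (le_trans (cP y))// lerDl.
apply: (@le_trans _ _ (n.+1%:R / N.+1%:R)).
  by rewrite mxE ler_pM2r ?invr_gt0// ler_nat.
by rewrite lerDr; have [] := gS _ (simplex_gridpt R y).
Qed.

(** A cluster point [x] of the approximate solutions satisfies [x ord0 i <= g x ord0 i] for every
    [i]; as both sides sum to 1, they agree. *)
Theorem brouwer_simplex (R : realType) (n : nat)
    (g : 'rV[R]_n.+1 -> 'rV[R]_n.+1) :
  {within simplex R n.+1, continuous g} ->
  set_fun (simplex R n.+1) (simplex R n.+1) g ->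
  exists2 x, simplex R n.+1 x & g x = x.
Proof.
move=> /subspace_continuousP gc gS.
pose P N z := simplex R n.+1 z /\ forall i, exists y,
    [/\ simplex R n.+1 y,
        forall j, `|z ord0 j - y ord0 j| <= n.+1%:R / N.+1%:R
      & y ord0 i <= g y ord0 i + n.+1%:R / N.+1%:R].
have [u uP] : {u & forall N, P N (u N)}.
  apply: choice => N; have [z zS zP] := simplex_approx_fixed N gS.
  by exists z.
have [x [xS xcl]] : simplex R n.+1 `&` cluster (u @ \oo) !=set0.
  by apply: compact_simplex; exists 0%N => // N _; have [] := uP N.
exists x => //.
have le_g i : x ord0 i <= g x ord0 i.
  suff h (e : R) : 0 < e -> x ord0 i <= g x ord0 i + e by apply/ler_addgt0Pr.
  move=> e0.
  have e3 : 0 < e / 4 by rewrite divr_gt0.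
  have : \forall y \near within (simplex R n.+1) (nbhs x), ball (g x) (e / 4) (g y).
    by have /(gc x xS) := nbhsx_ballx (g x) _ e3.
  rewrite near_withinE => /nbhs_ballP[d /= d0 dP].
  (* [y] will be within [2 * r <= d] of [x] and satisfy its inequality up to [r]; with the variation
     [e / 4] of [g], the total error is at most [3 * r + e / 4 <= e]. *)
  pose r := Num.min (d / 2) (e / 4).
  have r0 : 0 < r by rewrite lt_min divr_gt0.
  have [K KP] : exists K, forall N, (K <= N)%N -> n.+1%:R / N.+1%:R < r.
    exists (Num.truncn (n.+1%:R / r)) => N.
    by rewrite truncn_le_nat ltr_pdivrMr// ltr_pdivrMr// mulrC.
  have [z [[N /= KN uN] xz]] :
      ([set u N | N in [set N | (K <= N)%N]] `&` ball x r) !=set0.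
    apply: xcl; last exact: nbhsx_ballx.
    by exists K => // N KN; exists N.
  have [_ /(_ i)[y [yS yz yi]]] := uP N.
  rewrite uN in yz; have Nr := KP N KN.
  have [rd re] : r <= d / 2 /\ r <= e / 4 by rewrite !ge_min !lexx orbT.
  have xy j : `|x ord0 j - y ord0 j| < r + r.
    rewrite -(subrKA (z ord0 j)) (le_lt_trans (ler_normD _ _))// ltrD//.
      by have [_] := xz; exact.
    exact: le_lt_trans (yz j) Nr.
  have /dP/(_ yS)[_ /(_ ord0 i)] : ball x d y.
    split=> // k j; rewrite (ord1 k); apply: lt_le_trans (xy j) _; lra.
  move=> gxy.
  have {}gxy : `|g x ord0 i - g y ord0 i| < e / 4 by exact: gxy.
  have {}yi : y ord0 i <= g y ord0 i + r by rewrite (le_trans yi)// lerD2l ltW.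
  have := xy i; rewrite !ltr_norml in gxy * => /andP[xy1 xy2].
  by case/andP: gxy => g1 g2; lra.
apply/rowP => i; apply/eqP; rewrite -subr_eq0; apply/eqP.
apply: (@psumr_eq0P _ _ predT (fun i => g x ord0 i - x ord0 i)) => // [j _|].
  by rewrite subr_ge0.
by rewrite sumrB (gS _ xS).2 xS.2 subrr.
Qed.

(** * Schauder's theorem *)

Lemma convex_set_comb (R : realType) (X : lmodType R) (C : set X) (x y : X)
    (t : R) :
  convex_set C -> C x -> C y -> 0 <= t -> t <= 1 ->
  C (t *: x + (1 - t) *: y).
Proof.
move=> Cc Cx Cy t0 t1; apply/set_mem.
exact: (Cc x y (Itv01 t0 t1) (mem_set Cx) (mem_set Cy)).
Qed.

(** Partial sums of total weight [a] lie in [a *: C]; adding two of them renormalises by [a + a'],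
    the case of zero total weight being separate. *)
Lemma convex_set_sum (R : realType) (X : lmodType R) (C : set X) (n : nat)
    (w : 'I_n -> R) (y : 'I_n -> X) :
  C !=set0 -> convex_set C -> (forall i, C (y i)) -> (forall i, 0 <= w i) ->
  \sum_i w i = 1 -> C (\sum_i w i *: y i).
Proof.
move=> [c0 Cc0] Cc Cy w0 w1.
pose K (a : R) (b : X) := 0 <= a /\ exists2 z, C z & b = a *: z.
suff [_ [z Cz ->]] : K (\sum_i w i) (\sum_i w i *: y i).
  by rewrite w1 scale1r.
apply: (big_ind2 K) => [|a b a' b' [a0 [z Cz ->]] [a0' [z' Cz' ->]]|i _].
- by split=> //; exists c0 => //; rewrite scale0r.
- split; first exact: addr_ge0.
  have [/eqP|ne] := eqVneq (a + a') 0.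
    rewrite paddr_eq0// => /andP[/eqP -> /eqP ->].
    by exists z; rewrite // !scale0r !addr0 scale0r.
  have s0 : 0 < a + a' by rewrite lt_neqAle eq_sym ne addr_ge0.
  exists (a / (a + a') *: z + (1 - a / (a + a')) *: z').
    apply: convex_set_comb => //; first by rewrite divr_ge0// addr_ge0.
    by rewrite ler_pdivrMr// mul1r lerDl.
  rewrite scalerDr !scalerA mulrBr mulr1 mulrCA divff// mulr1.
  by rewrite [a + a' - a]addrAC subrr add0r.
- by split=> //; exists (y i).
Qed.

Lemma cvg_mx (T : Type) (F : set_system T) (FF : Filter F) (U : topologicalType)
    (m n : nat) (f : T -> 'M[U]_(m, n)) (M : 'M[U]_(m, n)) :
  (forall i j, f x i j @[x --> F] --> M i j) -> f x @[x --> F] --> M.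
Proof.
move=> h A [P /= PM PA]; rewrite nbhs_simpl /=.
apply: filterS (fun x => PA (f x)) _.
apply: filter_forall => i; apply: filter_forall => j.
exact: (h i j _ (PM i j)).
Qed.

(** Allows composition with a map that is continuous only on [D]. *)
Lemma cvg_to_within (T : Type) (F : set_system T) (FF : Filter F)
    (U : topologicalType) (h : T -> U) (D : set U) (u : U) :
  h t @[t --> F] --> u -> (\forall t \near F, D (h t)) ->
  h t @[t --> F] --> within D (nbhs u).
Proof.
by move=> hu hD A wA; apply: filterS2 hD (hu _ wA) => t Dt; exact.
Qed.

(** Balls centred in [A] cover its compact closure, and the centres of a finite subcover form the
    net. The index type ['I_n.+1] is the one for which Brouwer's theorem is stated. *)
Lemma precompact_net (R : realType) (X : normedModType R) (A : set X) (e : R) :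
  0 < e -> A !=set0 -> precompact A -> exists (n : nat) (y : 'I_n.+1 -> X),
    (forall i, A (y i)) /\ forall p, A p -> exists i, `|p - y i| < e.
Proof.
move=> e0 [a Aa]; rewrite precompactE compact_cover.
move=> /(_ X A (fun y => ball y e)).
case=> [y _|p clp|D' D'A cov].
- exact: ball_open.
- have [y [Ay py]] := clp _ (nbhsx_ballx p e e0).
  by exists y => //; exact: ball_sym.
have net p : A p -> exists2 y, y \in D' & `|p - y| < e.
  move=> /subset_closure /cov[y /= yD']; rewrite -ball_normE /= distrC.
  by exists y.
pose s := enum_fset D'.
have [ya yaD _] := net a Aa.
have s0 : (0 < size s)%N.
  rewrite lt0n size_eq0; apply/eqP => s0.
  by move: yaD; rewrite -[_ \in D']/(ya \in s) s0.
exists (size s).-1, (fun i => nth 0 s i); split=> [i|p /net[y yD py]].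
  apply/set_mem/D'A; rewrite -[_ \in D']/(_ \in s) mem_nth//.
  by apply: leq_trans (ltn_ord i) _; rewrite prednK.
have ys : (index y s < (size s).-1.+1)%N by rewrite prednK// index_mem.
by exists (Ordinal ys) => /=; rewrite nth_index.
Qed.

Lemma approx_fixed_point (R : realType) (X : normedModType R) (C : set X)
    (f : X -> X) (e : R) :
  convex_set C -> C !=set0 -> {within C, continuous f} ->
  set_fun C C f -> precompact (f @` C) -> 0 < e ->
  exists2 x, C x & `|f x - x| <= e.
Proof.
move=> Cc C0 /subspace_continuousP fc fC fK e0.
have [n [y [yfC net]]] : exists (n : nat) (y : 'I_n.+1 -> X),
    (forall i, (f @` C) (y i)) /\
    forall p, (f @` C) p -> exists i, `|p - y i| < e.
  apply: precompact_net => //.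
  by have [c Cc0] := C0; exists (f c); exists c.
have yC i : C (y i) by have [x Cx <-] := yfC i; exact: fC.
(* Twice the positive part of [e - `|p - y i|]: the Schauder projection. *)
pose wt (p : X) (i : 'I_n.+1) : R := (e - `|p - y i|) + `|e - `|p - y i| |.
have wt_ge0 p i : 0 <= wt p i.
  by have := ler_norm (- (e - `|p - y i|)); rewrite normrN /wt; lra.
have wt_gt0 p i : `|p - y i| < e -> 0 < wt p i.
  by move=> pe; rewrite /wt ger0_norm ?subr_ge0 ?ltW// addr_gt0// subr_gt0.
have wt_eq0 p i : e <= `|p - y i| -> wt p i = 0.
  by move=> pe; rewrite /wt ler0_norm ?subr_le0// subrr.
pose S p := \sum_i wt p i.
have S_gt0 p : (f @` C) p -> 0 < S p.
  move=> /net[i pi]; rewrite /S (bigD1 i)//= ltr_pwDl ?wt_gt0//.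
  exact: sumr_ge0.
pose comb (l : 'rV[R]_n.+1) := \sum_i l ord0 i *: y i.
have combC l : simplex R n.+1 l -> C (comb l).
  by move=> [l0 l1]; exact: convex_set_sum.
have comb_cont : continuous comb.
  move=> l; apply: cvg_big => [||i _]; first exact: add_continuous.
    exact: nbhs_filter.
  by apply: cvgZr_tmp; [exact: nbhs_filter|exact: coord_continuous].
pose g l := \row_i (wt (f (comb l)) i / S (f (comb l))).
have SfC l : simplex R n.+1 l -> 0 < S (f (comb l)).
  by move=> /combC Cl; apply: S_gt0; exists (comb l).
have gS : set_fun (simplex R n.+1) (simplex R n.+1) g.
  move=> l sl; have S0 := SfC l sl; split=> [i|].
    by rewrite mxE divr_ge0// ltW.
  under eq_bigr do rewrite mxE.
  by rewrite -mulr_suml divff// gt_eqF.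
have gc : {within simplex R n.+1, continuous g}.
  apply/subspace_continuousP => l sl.
  have fcomb : f (comb k) @[k --> within (simplex R n.+1) (nbhs l)] --> f (comb l).
    apply: cvg_comp (fc _ (combC l sl)).
    apply: cvg_to_within; first exact: cvg_within_filter (comb_cont l).
    by apply: filterS (withinT _ _) => k; exact: combC.
  have wtc i : wt (f (comb k)) i @[k --> within (simplex R n.+1) (nbhs l)]
      --> wt (f (comb l)) i.
    have h : e - `|f (comb k) - y i| @[k --> within (simplex R n.+1) (nbhs l)]
        --> e - `|f (comb l) - y i|.
      apply: cvgB; first exact: cvg_cst.
      by apply: cvg_norm; apply: cvgB => //; exact: cvg_cst.
    by apply: cvgD => //; exact: cvg_norm.
  apply: cvg_mx => i j; rewrite /g /from_subspace mxE.
  under eq_cvg do rewrite mxE.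
  apply: cvgM => //; apply: cvgV; first by rewrite gt_eqF// SfC.
  by apply: cvg_big => [|//]; exact: add_continuous.
have [l sl gl] := brouwer_simplex gc gS.
exists (comb l); first exact: combC.
set p := f (comb l).
have lE i : l ord0 i = wt p i / S p by rewrite -[in LHS]gl mxE.
(* An average of the [p - y i], whose weights vanish as soon as [|p - y i|] is at least [e]. *)
have -> : p - comb l = \sum_i l ord0 i *: (p - y i).
  under eq_bigr do rewrite scalerBr.
  by rewrite sumrB -scaler_suml sl.2 scale1r.
apply: le_trans (ler_norm_sum _ _ _) _.
rewrite -[leRHS]mul1r -sl.2 mulr_suml; apply: ler_sum => i _.
rewrite normrZ ger0_norm; last exact: sl.1.
have [pe|pe] := ltP `|p - y i| e.
  by rewrite ler_wpM2l ?(ltW pe)//; exact: sl.1.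
by rewrite lE wt_eq0// !mul0r.
Qed.

(** For approximate fixed points [u N], precompactness yields a cluster point [z] of [f (u N)].
    Since [u N] is close to [f (u N)], continuity at [z] gives [f z = z]. *)
Theorem schauder_fixed_point (R : realType) (X : normedModType R) (C : set X)
    (f : X -> X) :
  closed C -> convex_set C -> C !=set0 -> {within C, continuous f} ->
  set_fun C C f -> precompact (f @` C) -> exists2 x, C x & f x = x.
Proof.
move=> Ccl Cc C0 fc fC fK.
pose P N x := C x /\ `|f x - x| <= N.+1%:R^-1.
have [u uP] : {u & forall N, P N (u N)}.
  apply: choice => N.
  have [|x Cx xN] := @approx_fixed_point R X C f N.+1%:R^-1 Cc C0 fc fC fK.
    by rewrite invr_gt0.
  by exists x.
have [z [zK zcl]] : closure (f @` C) `&` cluster (f (u N) @[N --> \oo]) !=set0.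
  move: fK; rewrite precompactE; apply.
  exists 0%N => // N _; apply: subset_closure; exists (u N) => //.
  exact: (uP N).1.
have Cz : C z.
  rewrite ((closure_id C).1 Ccl); apply: closure_subset zK.
  by move=> _ [x Cx <-]; exact: fC.
exists z => //.
suff h (e : R) : 0 < e -> `|f z - z| <= 0 + e.
  by apply/eqP; rewrite -subr_eq0 -normr_le0; apply/ler_addgt0Pr.
rewrite add0r => e0; have e2 : 0 < e / 2 by rewrite divr_gt0.
move/subspace_continuousP: fc => /(_ z Cz) fc.
have /fc := nbhsx_ballx (f z) _ e2.
rewrite nbhs_simpl /within /= => /nbhs_ballP[d /= d0 dP].
(* [f (u N)] will be within [r] of both [z] and [u N], so [u N] is within [2 * r <= d] of [z]. *)
pose r := Num.min (d / 2) (e / 2).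
have r0 : 0 < r by rewrite lt_min divr_gt0.
have [rd re] : r <= d / 2 /\ r <= e / 2 by rewrite !ge_min !lexx orbT.
have [w [[N /= KN uN] zw]] :
    ([set f (u N) | N in [set N | N.+1%:R^-1 < r]] `&` ball z r) !=set0.
  apply: zcl; last exact: nbhsx_ballx.
  exists (Num.truncn r^-1) => // N /= KN; exists N => //=.
  by rewrite -[ltRHS]invrK ltf_pV2 ?posrE ?invr_gt0// -truncn_le_nat.
have [CN fN] := uP N.
rewrite -ball_normE /= -uN in zw.
have fzN : `|f z - f (u N)| < e / 2.
  have : ball (f z) (e / 2) (f (u N)).
    apply: dP => //; rewrite -ball_normE /= -(subrKA (f (u N))).
    apply: (le_lt_trans (ler_normD _ _)).
    by have := le_lt_trans fN KN; lra.
  by rewrite -ball_normE.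
rewrite -(subrKA (f (u N))) (le_trans (ler_normD _ _))//.
by rewrite [X in _ + X <= _]distrC; lra.
Qed.

(** * The fixed point theorem *)

(** Near [p], [s] takes values in the compact [[a, b]]. By continuity of [G] each cluster value is a
    root at [p], hence [s p], and a unique cluster value is a limit. The strict bounds make [[a, b]]
    a neighbourhood of [s p]. *)
Lemma cvg_unique_root (R : realType) (T : topologicalType) (A : set T)
    (G : R * T -> R) (s : T -> R) (p : T) (a b : R) :
  A p -> a < s p < b ->
  (\forall q \near within A (nbhs p), a <= s q <= b /\ G (s q, q) = 0) ->
  (forall t, a <= t <= b ->
    G x @[x --> within (`[a, b] `*` A) (nbhs (t, p))] --> G (t, p)) ->
  (forall t, a <= t <= b -> G (t, p) = 0 -> t = s p) ->
  s q @[q --> within A (nbhs p)] --> s p.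
Proof.
move=> Ap /andP[asp spb] near_s Gc uniq.
have pA : ProperFilter (within A (nbhs p)).
  by apply: within_nbhs_proper; exact: subset_closure.
have sV : (s @ within A (nbhs p)) `[a, b]%classic.
  by apply: filterS near_s => q [sq _] /=; rewrite in_itv.
have cl t : cluster (s @ within A (nbhs p)) t -> t = s p.
  move=> tcl.
  have tab : a <= t <= b.
    have : closure `[a, b]%classic t by move: tcl; rewrite clusterE; exact.
    by rewrite -(closure_id _).1 /= ?in_itv//; exact: itv_closed.
  apply: uniq => //; apply/eqP; apply: contrapT => /negP G0.
  (* [G] would be nonzero on a neighbourhood [U] x [V] of [(t, p)], relative to the domain, while
     clustering at [t] gives [q] in [V] with [s q] in [U] and [G (s q, q) = 0]. *)
  have := Gc t tab [set y | y != 0] (open_nbhs_nbhs (conj (@open_neq R 0) G0)).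
  rewrite nbhs_simpl /within /= => -[[U V] /= [Ut Vp] UV].
  have sAV : (s @ within A (nbhs p))
      (s @` [set q | [/\ V q, A q, a <= s q <= b & G (s q, q) = 0]]).
    have nV : \forall q \near within A (nbhs p), V q by exact: cvg_within.
    apply: filterS3 nV near_s (withinT A (nbhs_filter p)) => q Vq [sq Gq] Aq.
    by exists q.
  have [_ [[q [Vq Aq sq Gq] <-] Uq]] := tcl _ _ sAV Ut.
  have /= := UV (s q, q) (conj Uq Vq); rewrite in_itv /= Gq eqxx.
  by move=> /(_ (conj sq Aq)).
apply: (compact_cluster_set1 (@Rhausdorff R) (@segment_compact R a b)) => //.
  have : s p \in `]a, b[ by rewrite in_itv /= asp.
  move=> /near_in_itvoo; apply: filterS => t /=.
  by rewrite !in_itv /= => /andP[/ltW -> /ltW ->].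
apply/seteqP; split=> [t /cl //|_ ->].
have [t [_ tcl]] := @segment_compact R a b _ _ sV.
by rewrite -(cl t tcl).
Qed.

Lemma closed_setX (U V : topologicalType) (A : set U) (B : set V) :
  closed A -> closed B -> closed (A `*` B).
Proof.
move=> Acl Bcl; have -> : A `*` B = fst @^-1` A `&` snd @^-1` B by [].
apply: closedI.
  have /continuous_closedP : continuous (@fst U V) by move=> x; exact: cvg_fst.
  exact.
have /continuous_closedP : continuous (@snd U V) by move=> x; exact: cvg_snd.
exact.
Qed.

Lemma convex_setX (R : numDomainType) (U V : lmodType R) (A : set U)
    (B : set V) :
  convex_set A -> convex_set B -> convex_set (A `*` B : set (U * V)%type).
Proof.
move=> Ac Bc x y l /set_mem[Ax Bx] /set_mem[Ay By]; apply/mem_set; split.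
  by apply/set_mem/Ac; exact: mem_set.
by apply/set_mem/Bc; exact: mem_set.
Qed.

Theorem theorem2p6 (R : realType) (X1 X2 : completeNormedModType R)
  (K1 : set X1) (D : set X2)
  (T1 : X1 * X2 -> X1) (T2 : X1 * X2 -> X2)
  (F : X1 * X1 -> R) (s : X1 * X2 -> R)
  (hK1 : nondegenerate_cone K1)
  (hD0 : D !=set0) (hDb : bounded_set D) (hDc : closed D) (hDv : convex_set D)
  (hTKD : set_fun (K1 `*` D) (K1 `*` D) (fun p => (T1 p, T2 p)))
  (hTcc : completely_continuous (K1 `*` D) (fun p => (T1 p, T2 p)))
  (hFc : {within K1 `*` K1, continuous F})
  (hF : forall (u : X1) (l : R), (K1 `\ 0) u -> 0 < l ->
    (F (l *: u, u) = 0 <-> l = 1))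
  (h1 : forall (u : X1) (v : X2), (K1 `\ 0) u -> D v ->
    unique (fun t : R => 0 < t /\ F (T1 (t *: u, v), t *: u) = 0) (s (u, v)))
  (h2 : exists m M : R, [/\ 0 < m, m < M,
    (m%:E < ereal_inf [set (s p)%:E | p in unit_sphere K1 `*` D])%E
    & (ereal_sup [set (s p)%:E | p in unit_sphere K1 `*` D] < M%:E)%E]) :
  exists (u : X1) (v : X2),
    [/\ K1 u, D v, T1 (u, v) = u, T2 (u, v) = v
      & (~ exists vbar : X2,
            [/\ D vbar, T1 (0, vbar) = 0 & T2 (0, vbar) = vbar]) ->
        Ub K1 D s (u, v)].
Proof.
have [Kcl Kcv Kscale [u0 [Ku0 _]]] := hK1.
have K0 : K1 0 by rewrite -(scale0r u0); exact: Kscale.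
have [m [M [m0 mM hm hM]]] := h2.
have [/subspace_continuousP Tc Tcomp] := hTcc.
have s_pos u v : (K1 `\ 0) u -> D v -> 0 < s (u, v).
  by move=> Ku Dv; have [[]] := h1 u v Ku Dv.
have s_root u v : (K1 `\ 0) u -> D v ->
    F (T1 (s (u, v) *: u, v), s (u, v) *: u) = 0.
  by move=> Ku Dv; have [[]] := h1 u v Ku Dv.
have s_uniq u v t : (K1 `\ 0) u -> D v -> 0 < t ->
    F (T1 (t *: u, v), t *: u) = 0 -> t = s (u, v).
  by move=> Ku Dv t0 Ft; have [_ /(_ t)] := h1 u v Ku Dv => ->.
have KscaleN0 u t : (K1 `\ 0) u -> 0 < t -> (K1 `\ 0) (t *: u).
  move=> [Ku u_neq0] t0; split; first exact: Kscale (ltW t0) Ku.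
  move=> /= /eqP; rewrite scaler_eq0 gt_eqF//= => /eqP; exact: u_neq0.
(* Both sides are the root on the ray through [u]. *)
have s_scale u v t : (K1 `\ 0) u -> D v -> 0 < t ->
    s (t *: u, v) * t = s (u, v).
  move=> Ku Dv t0; have Ktu := KscaleN0 u t Ku t0.
  apply: s_uniq => //; first by rewrite mulr_gt0// s_pos.
  by rewrite -scalerA; exact: s_root.
(* By homogeneity, (h2) passes from the unit sphere to all of [K1 \ 0]. *)
have s_bounds u v : (K1 `\ 0) u -> D v ->
    m < s (u, v) * `|u| < M.
  move=> Ku Dv; have u_gt0 : 0 < `|u| by rewrite normr_gt0; apply/eqP; exact: Ku.2.
  have ui_gt0 : 0 < `|u|^-1 by rewrite invr_gt0.
  rewrite -(s_scale u v `|u|^-1)// mulfVK ?gt_eqF//.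
  have US : (unit_sphere K1 `*` D) (`|u|^-1 *: u, v).
    split=> //; split=> /=; first by have [] := KscaleN0 _ _ Ku ui_gt0.
    by rewrite normrZ gtr0_norm// mulVf// gt_eqF.
  have [hmu hMu] : (m%:E < (s (`|u|^-1 *: u, v))%:E)%E /\
      ((s (`|u|^-1 *: u, v))%:E < M%:E)%E.
    split.
      apply: lt_le_trans hm _; apply: ereal_inf_lbound.
      by exists (`|u|^-1 *: u, v).
    by apply: le_lt_trans hM; apply: ereal_sup_ubound; exists (`|u|^-1 *: u, v).
  by rewrite !lte_fin in hmu hMu; rewrite hmu.
(* Joint continuity of the function whose root is [s]; a positive [a] keeps the scaled points in the
   cone. *)
have Gc (t : R) (p : X1 * X2) (a b : R) : 0 < a -> a <= t <= b -> (K1 `*` D) p ->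
    F (T1 (x.1 *: x.2.1, x.2.2), x.1 *: x.2.1)
      @[x --> within (`[a, b]%classic `*` (K1 `*` D)) (nbhs (t, p))] -->
    F (T1 (t *: p.1, p.2), t *: p.1).
  move=> a0 tab [/= Kp Dp]; set Fl := within _ _.
  have inFl : \forall x \near Fl, a <= x.1 /\ (K1 `*` D) x.2.
    apply: filterS (withinT _ (nbhs_filter _)) => x [/=].
    by rewrite in_itv /= => /andP[].
  have cvg1 : x.1 @[x --> Fl] --> t by apply: cvg_within_filter; exact: cvg_fst.
  have cvg2 : x.2 @[x --> Fl] --> p by apply: cvg_within_filter; exact: cvg_snd.
  have cvg21 : x.2.1 @[x --> Fl] --> p.1 by apply: cvg_comp cvg2 _; exact: cvg_fst.
  have cvg22 : x.2.2 @[x --> Fl] --> p.2 by apply: cvg_comp cvg2 _; exact: cvg_snd.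
  have cvgS : x.1 *: x.2.1 @[x --> Fl] --> t *: p.1 by exact: cvgZ.
  have KS (x : R * (X1 * X2)) : a <= x.1 /\ (K1 `*` D) x.2 ->
      (K1 `*` D) (x.1 *: x.2.1, x.2.2).
    move=> [ax [Kx Dx]]; split=> //=; apply: Kscale => //.
    exact: le_trans (ltW a0) ax.
  have KStp : (K1 `*` D) (t *: p.1, p.2).
    by apply: (KS (t, p)); split=> //=; case/andP: tab.
  have cvgT : (T1 (x.1 *: x.2.1, x.2.2), T2 (x.1 *: x.2.1, x.2.2)) @[x --> Fl]
      --> (T1 (t *: p.1, p.2), T2 (t *: p.1, p.2)).
    apply: cvg_comp (Tc _ KStp); apply: cvg_to_within; first exact: cvg_pair.
    by apply: filterS inFl => x; exact: KS.
  have cvgT1 : T1 (x.1 *: x.2.1, x.2.2) @[x --> Fl] --> T1 (t *: p.1, p.2).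
    have fst_cont : continuous (@fst X1 X2) by move=> x; exact: cvg_fst.
    exact: continuous_cvg (fst_cont _) cvgT.
  move/subspace_continuousP: hFc => Fc; apply: cvg_comp (Fc _ _); last first.
    by split=> /=; [have [] := hTKD _ KStp|exact: KStp.1].
  apply: cvg_to_within; first exact: cvg_pair.
  apply: filterS inFl => x /KS KSx; split=> /=; last exact: KSx.1.
  by have [] := hTKD _ KSx.
(* [r] is the identity near [u = 0], where the junk value of [s] is harmless
   because it multiplies [0]. *)
pose r (p : X1 * X2) : X1 * X2 := (Num.min 1 (s p) *: p.1, p.2).
have rK : set_fun (K1 `*` D) (K1 `*` D) r.
  move=> [u v] [/= Ku Dv]; split=> //=.
  have [->|u_neq0] := eqVneq u 0; first by rewrite scaler0.
  apply: Kscale => //; rewrite le_min ler01 ltW// s_pos//.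
  by split=> //; exact/eqP.
(* The range of [r] is bounded although [K1] is not: [min 1 s * |u| <= s * |u| < M]. *)
have rM p : (K1 `*` D) p -> `|(r p).1| <= M.
  case: p => u v [/= Ku Dv].
  have [->|u_neq0] := eqVneq u 0; first by rewrite scaler0 normr0 ltW// (lt_trans m0).
  have KN0 : (K1 `\ 0) u by split=> //; exact/eqP.
  have s0 := s_pos u v KN0 Dv; have /andP[_ suM] := s_bounds u v KN0 Dv.
  rewrite normrZ ger0_norm ?le_min ?ler01 ?(ltW s0)//.
  by apply: le_trans (ltW suM); rewrite ler_wpM2r// ge_min lexx orbT.
have rc : {within K1 `*` D, continuous r}.
  apply/subspace_continuousP => -[u v] [/= Ku Dv].
  have cvg1 : q.1 @[q --> within (K1 `*` D) (nbhs (u, v))] --> u.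
    by apply: cvg_within_filter; exact: cvg_fst.
  have cvg2 : q.2 @[q --> within (K1 `*` D) (nbhs (u, v))] --> v.
    by apply: cvg_within_filter; exact: cvg_snd.
  have inKD := withinT (K1 `*` D) (nbhs_filter (u, v)).
  have FW : Filter (within (K1 `*` D) (nbhs (u, v))).
    by apply: within_filter; exact: nbhs_filter.
  rewrite /from_subspace.
  have [u0E|u_neq0] := eqVneq u 0.
    have -> : r (u, v) = (u, v) by rewrite /r /= u0E scaler0.
    (* From [m < s * |u|], [|u| < m] forces [s > 1]. *)
    have near_id : within (K1 `*` D) (nbhs (u, v)) [set q | q = r q].
      have um : `|u| < m by rewrite u0E normr0.
      have small : within (K1 `*` D) (nbhs (u, v)) [set q | `|q.1| < m] :=
        @cvgr_norm_lt _ _ _ _ FW _ u cvg1 m um.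
      apply: (@filterS2 _ _ FW) small inKD => -[u' v'] /= u'm [/= Ku' Dv'].
      rewrite /r /=; have [->|u'_neq0] := eqVneq u' 0; first by rewrite scaler0.
      have KN0 : (K1 `\ 0) u' by split=> //; exact/eqP.
      have /andP[ms _] := s_bounds u' v' KN0 Dv'.
      have u'_gt0 : 0 < `|u'| by rewrite normr_gt0.
      have s1 : 1 <= s (u', v').
        by rewrite -(ler_pM2r u'_gt0) mul1r ltW// (lt_trans u'm).
      by rewrite min_l// scale1r.
    apply: cvg_trans (near_eq_cvg near_id) _.
    by apply: cvg_within_filter; exact: cvg_id.
  have KN0 : (K1 `\ 0) u by split=> //; exact/eqP.
  have u_gt0 : 0 < `|u| by rewrite normr_gt0.
  have scvg : s q @[q --> within (K1 `*` D) (nbhs (u, v))] --> s (u, v).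
    have /andP[ms sM] := s_bounds u v KN0 Dv.
    have M0 : 0 < M by exact: lt_trans mM.
    (* These enclose [s (u', v')] as long as [|u| / 2 < |u'| < 2 * |u|]. *)
    pose a := m / (2 * `|u|); pose b := M * 2 / `|u|.
    have a0 : 0 < a by rewrite divr_gt0// mulr_gt0.
    apply: (@cvg_unique_root R _ (K1 `*` D)
      (fun x => F (T1 (x.1 *: x.2.1, x.2.2), x.1 *: x.2.1)) s (u, v) a b) => //.
    - rewrite /a /b ltr_pdivrMr ?mulr_gt0// ltr_pdivlMr//.
      by apply/andP; split; nra.
    - have ult : `|u| < 2 * `|u| by lra.
      have ugt : `|u| / 2 < `|u| by lra.
      have up : within (K1 `*` D) (nbhs (u, v)) [set q | `|q.1| < 2 * `|u|] :=
        @cvgr_norm_lt _ _ _ _ FW _ u cvg1 (2 * `|u|) ult.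
      have down : within (K1 `*` D) (nbhs (u, v)) [set q | `|u| / 2 < `|q.1|] :=
        @cvgr_norm_gt _ _ _ _ FW _ u cvg1 (`|u| / 2) ugt.
      apply: (@filterS3 _ _ FW) up down inKD => -[u' v'] /= u'up u'down [/= Ku' Dv'].
      have KN0' : (K1 `\ 0) u'.
        split=> // /= u'0; move: u'down; rewrite u'0 normr0; lra.
      have /andP[ms' sM'] := s_bounds u' v' KN0' Dv'.
      have s0' := s_pos u' v' KN0' Dv'.
      split; last exact: s_root.
      rewrite /a /b ler_pdivrMr ?mulr_gt0// ler_pdivlMr//.
      by apply/andP; split; nra.
    - by move=> t tab; exact: Gc.
    - move=> t /andP[ta _] /= Gt; apply: s_uniq => //; exact: lt_le_trans ta.
  apply: cvg_pair => //=; apply: cvgZ => //.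
  have min_cont : {for s (u, v), continuous ((cst 1 : R -> R) \min id)}.
    by apply: continuous_min; [exact: cst_continuous|exact: cvg_id].
  exact: continuous_cvg min_cont scvg.
have [[u v] [/= Ku Dv] fix_uv] : exists2 p, (K1 `*` D) p &
    (fun q => (T1 (r q), T2 (r q))) p = p.
  apply: schauder_fixed_point.
  - exact: closed_setX.
  - exact: convex_setX.
  - by have [d Dd] := hD0; exists (0, d).
  - apply/subspace_continuousP => p KDp.
    apply: cvg_comp (Tc _ (rK _ KDp)); apply: cvg_to_within.
      by move/subspace_continuousP: rc; exact.
    by apply: filterS (withinT _ (nbhs_filter p)) => q; exact: rK.
  - by move=> p KDp; apply: hTKD; exact: rK.
  (* The range of [r] lies in the bounded set [B], which [T] maps to a precompact set. *)
  - pose B := [set q : X1 * X2 | (K1 `*` D) q /\ `|q.1| <= M].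
    apply: (@precompact_subset _ _ [set (T1 q, T2 q) | q in B]).
      move=> _ [q KDq <-]; exists (r q) => //.
      by split; [exact: rK|exact: rM].
    apply: Tcomp; first by move=> q [].
    have [d [_ dP]] := hDb.
    exists (Num.max d M); split; first exact: num_real.
    move=> N; rewrite gt_max => /andP[dN MN] q [[_ Dq] qM].
    rewrite /= prod_normE ge_max (le_trans qM (ltW MN)) /=.
    exact: dP Dq.
have r_uv : r (u, v) = (u, v).
  rewrite /r /=; have [ueq0|u_neq0] := eqVneq u 0; first by rewrite ueq0 scaler0.
  have KN0 : (K1 `\ 0) u by split=> //; exact/eqP.
  have s0 := s_pos u v KN0 Dv.
  have [s1|s1] := leP 1 (s (u, v)); first by rewrite scale1r.
  have Ksu := KscaleN0 _ _ KN0 s0.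
  have si0 : 0 < (s (u, v))^-1 by rewrite invr_gt0.
  have Fsu : F (u, s (u, v) *: u) = 0.
    have [fix1 _] := fix_uv; rewrite -{1}fix1 /r /= min_r ?ltW//.
    exact: s_root.
  (* At the point [s (u, v) *: u] with factor [(s (u, v))^-1], [hF] forces [s (u, v) = 1]. *)
  have [+ _] := hF _ _ Ksu si0.
  rewrite scalerA mulVf ?gt_eqF// scale1r => /(_ Fsu)/(canRL invrK).
  by rewrite invr1 => ->; rewrite scale1r.
rewrite r_uv in fix_uv; have [fix1 fix2] := fix_uv.
exists u, v; split=> // no0.
have KN0 : (K1 `\ 0) u.
  split=> // /= ueq0; apply: no0; by exists v; rewrite -ueq0.
(* As [T1 (u, v) = u] and [F (u, u) = 0], the number 1 is the root defining [s (u, v)]. *)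
split=> //; apply/esym; apply: s_uniq => //; rewrite scale1r fix1.
by have [_ /(_ erefl)] := hF u 1 KN0 ltr01; rewrite scale1r.
Qed.
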